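(* Let $d\ge1$ and let $\pi\colon X\to Y$ be a factor map between the topological dynamical systems $(X,T,\mathbb{Z}^d)$ and $(Y,S,\mathbb{Z}^d)$. Assume that $\pi$ is not bounded to one. Then any closed half-space $H=\{x\in\mathbb{R}^d:\langle x,c\rangle\ge0\}$, $c\in\mathbb{R}^d\setminus\{0\}$, contains a $\pi$-nondeterministic vector, i.e. $$\operatorname{ND}_{\ell_2}(X,\pi)\cap H\neq\emptyset.$$
   Context: A topological dynamical system $(X,T,\mathbb{Z}^d)$ is an action of $\mathbb{Z}^d$ by homeomorphisms $T_g$, $g\in\mathbb{Z}^d$, on a compact metric space $X$ with distance $\operatorname{dist}$. A factor map $\pi\colon X\to Y$ is a continuous onto map with $S_g\circ\pi=\pi\circ T_g$ for all $g\in\mathbb{Z}^d$. It is bounded to one if the cardinality of its fibers is uniformly bounded by a finite constant. For $\epsilon>0$, $\operatorname{ND}_{\ell_2}(X,\epsilon,\pi)$ is the set of unit vectors $v\in\mathbb{S}^{d-1}$ for which there exist two different points $x,y\in X$ with $\pi(x)=\pi(y)$ and $\operatorname{dist}(T_gx,T_gy)\le\epsilon$ for all $g\in\mathbb{Z}^d$ with $\langle g,v\rangle<0$. Set $\operatorname{ND}_{\ell_2}(X,\pi)=\bigcap_{\epsilon>0}\operatorname{ND}_{\ell_2}(X,\epsilon,\pi)$; its elements are called $\pi$-nondeterministic vectors. *)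

(* Defs.v *)
From HB Require Import structures.
From mathcomp Require Import all_boot all_order all_algebra.
From mathcomp Require Import all_classical all_reals all_analysis.

Set Implicit Arguments.
Unset Strict Implicit.
Unset Printing Implicit Defensive.

Import Order.TTheory GRing.Theory Num.Theory.

Local Open Scope classical_set_scope.
Local Open Scope ring_scope.

Definition homeomorphism (X Y : topologicalType) (f : X -> Y) : Prop :=
  continuous f /\
  exists2 f' : Y -> X, continuous f' & cancel f f' /\ cancel f' f.

Record dynamical_system (R : realType) (d : nat) (X : metricType R)
    (T : 'rV[int]_d -> X -> X) : Prop := DynamicalSystem {
  tds_compact : compact [set: X];
  tds_homeo : forall g, homeomorphism (T g);
  tds_act0 : forall x, T 0 x = x;
  tds_actD : forall g h x, T (g + h) x = T g (T h x)
}.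

Record factor_map (R : realType) (d : nat) (X Y : metricType R)
    (T : 'rV[int]_d -> X -> X) (S : 'rV[int]_d -> Y -> Y)
    (pi : X -> Y) : Prop := FactorMap {
  factor_continuous : continuous pi;
  factor_onto : set_surj [set: X] [set: Y] pi;
  factor_equivariant : forall g, S g \o pi =1 pi \o T g
}.

Definition bounded_to_one (X Y : Type) (pi : X -> Y) : Prop :=
  exists n : nat, forall y, (pi @^-1` [set y] #<= `I_n)%card.

Definition dotp (R : realType) (d : nat) (u v : 'rV[R]_d) : R :=
  \sum_(i < d) u 0 i * v 0 i.

(* The library's norm on 'rV[R]_d is the sup norm. *)
Definition l2norm (R : realType) (d : nat) (v : 'rV[R]_d) : R :=
  Num.sqrt (dotp v v).

Definition unit_sphere (R : realType) (d : nat) : set 'rV[R]_d :=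
  [set v | l2norm v = 1].

Definition half_space (R : realType) (d : nat) (c : 'rV[R]_d) : set 'rV[R]_d :=
  [set x | 0 <= dotp x c].

Definition ND_eps (R : realType) (d : nat) (X : metricType R) (Y : Type)
    (T : 'rV[int]_d -> X -> X) (pi : X -> Y) (eps : R) : set 'rV[R]_d :=
  [set v | unit_sphere v /\
    exists x y : X, [/\ x <> y, pi x = pi y &
      forall g : 'rV[int]_d, dotp (map_mx intr g) v < 0 ->
        mdist (T g x) (T g y) <= eps]].

Definition ND (R : realType) (d : nat) (X : metricType R) (Y : Type)
    (T : 'rV[int]_d -> X -> X) (pi : X -> Y) : set 'rV[R]_d :=
  \bigcap_(eps in [set e : R | 0 < e]) ND_eps T pi eps.

(* Main.v *)
Require Import Defs.
From mathcomp Require Import all_boot all_order all_algebra.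
From mathcomp Require Import all_classical all_reals all_analysis.
From mathcomp Require Import finmap ring lra.

(** Suppose first that for every [eps > 0] some pair of distinct points in a
    common fibre stays [eps]-close along its whole orbit. Then every unit
    vector is nondeterministic, and [c / |c|] lies in the half-space. Otherwise
    there is [e > 0] such that any two distinct points of a fibre are somewhere
    more than [e] apart ([fibre_separated]): the system is expansive along the
    fibres, and [e] is kept fixed. Say that a pair agrees at [g] when the
    [T g]-images are at distance at most [e].

    The core is a first contact argument. Take [|c| = 1], a small [a > 0], a
    large [r], and the balls of center [k a c] and radius [r + k a^2],
    [k = 0, 1, 2, ...]. The centers move [1 / a] times faster than the radii
    grow, so the part of the boundary that moves outward has its normal [v]
    in [<v, c> >= - a]. Nevertheless, seen from their own centers, the balls
    exhaust the lattice ([moving_ball_exhausts]). By total boundedness, among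
    sufficiently many points of a fibre, translated to the [k]-th center, two
    must agree on the initial ball; since the translation is arbitrary, [k] can
    be taken so large that these two also disagree somewhere in the [k]-th ball
    ([late_separation]; this is where unboundedness of the fibres is used). At
    the first ball containing a disagreement, translate that disagreement to
    the origin. The previous ball is then almost a half-space
    [{h : <h, v> < 0}] because its radius is large, the pair agrees on it, and
    [<v, c> > - a] ([almost_nondeterministic]). Letting [a -> 0] and
    [r -> oo] gives by compactness a pair separated at the origin, and a unit
    vector [v] with [<v, c> >= 0], such that the pair agrees on all of
    [{h : <h, v> < 0}] ([limit_nondeterministic]).

    It remains to replace [e] by an arbitrary [eps]. Compactness makes
    expansiveness uniform: agreement on a large box around a lattice point [g]
    forces the distance at [g] to be at most [eps] ([uniform_separation]). So
    the pair is [eps]-close on a half-space slightly smaller than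
    [{h : <h, v> < 0}], and translating the pair moves that half-space back
    onto the original one ([half_space_nondeterministic]).

    All limits are taken along one ultrafilter on the integers, so that every
    sequence in a compact space converges without extracting subsequences. *)

Set Implicit Arguments.
Unset Strict Implicit.
Unset Printing Implicit Defensive.

Import Order.TTheory GRing.Theory Num.Theory.
Import numFieldNormedType.Exports.

Local Open Scope classical_set_scope.
Local Open Scope ring_scope.

(** * Compactness and ultrafilter limits *)

(** A covering argument phrased with filters: the finite sequences are ordered
    by inclusion, and near-covering compactness is applied to the filter of
    sequences that are large for this order. *)
Lemma compact_finite_net (X : topologicalType) (N : X -> set X) :
  compact [set: X] -> (forall p, nbhs p (N p)) ->
  exists s : seq X, forall x, exists2 p, p \in s & N p x.
Proof.
move=> /compact_near_coveringP cX nN.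
pose F := filter_from [set: seq X] (fun s0 : seq X =>
    [set s : seq X | {subset s0 <= s}]).
have FF : Filter F.
  apply: filter_from_filter; first by exists [::].
  move=> s t _ _; exists (s ++ t) => // u su.
  by split=> p ps; apply: su; rewrite mem_cat ps ?orbT.
have [s _ /(_ s) cov] : F [set s : seq X |
    [set: X] `<=` (fun x => exists2 p, p \in s & N p x)].
  apply: (cX _ F (fun (s : seq X) x => exists2 p, p \in s & N p x) FF) => x _.
  exists (N x, [set s : seq X | {subset [:: x] <= s}]).
    by split=> //=; exists [:: x].
  by move=> [y s] /= [Ny xs]; exists x => //; apply: xs; rewrite inE.
by exists s => x; exact: cov.
Qed.

(** Along an ultrafilter, any cluster point is a limit. *)
Lemma ultra_compact_cvg (I : Type) (U : set_system I) (UU : UltraFilter U)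
    (X : topologicalType) (A : set X) (f : I -> X) :
  compact A -> (forall i, A (f i)) -> exists2 x, A x & f @ U --> x.
Proof.
move=> cA Af; have UA : U (f @^-1` A) by exact: filterE.
have [x [Ax fx]] := cA (fmap f U) _ UA.
exists x => // N Nx; have [//|nN] := in_ultra_setVsetC (f @^-1` N) UU.
by have [z []] := fx (~` N) N nN Nx.
Qed.

Lemma eventually_ultra : exists2 U : set_system nat, UltraFilter U & \oo `<=` U.
Proof. by have [U []] := ultraFilterLemma (eventually_filter); exists U. Qed.

Lemma cvg_mdist (R : realType) (X : metricType R) (I : Type) (F : set_system I)
    (FF : Filter F) (f g : I -> X) (x y : X) :
  f @ F --> x -> g @ F --> y ->
  mdist (f i) (g i) @[i --> F] --> mdist x y.
Proof.
move=> fx gy; apply/cvgrPdist_lt => e e0.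
have e2 : 0 < e / 2 by rewrite divr_gt0.
have fe := @metricType_numDomainType.cvgr_dist_lt _ _ _ F FF _ _ fx _ e2.
have ge := @metricType_numDomainType.cvgr_dist_lt _ _ _ F FF _ _ gy _ e2.
apply: (filterS2 _ _ fe ge) => i fi gi.
have h1 := metric_triangle x (f i) y.
have h2 := metric_triangle (f i) (g i) y.
have h3 := metric_triangle (f i) x (g i).
have h4 := metric_triangle x y (g i).
rewrite (metric_sym (g i) y) in h2; rewrite (metric_sym (f i) x) in h3.
rewrite ltr_norml; apply/andP; split; lra.
Qed.

(** Distances are carried along rather than the relation [x <> y], which is
    lost in the limit unless some distance stays bounded below. *)
Lemma ultra_pair_limit (R : realType) (d : nat) (X Y : metricType R)
    (T : 'rV[int]_d -> X -> X) (pi : X -> Y)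
    (tdsX : dynamical_system T) (cpi : continuous pi)
    (I : Type) (U : set_system I) (UU : UltraFilter U) (u w : I -> X) :
  (forall i, pi (u i) = pi (w i)) ->
  exists x y : X, pi x = pi y /\
    forall g, mdist (T g (u i)) (T g (w i)) @[i --> U] -->
      mdist (T g x) (T g y).
Proof.
move=> piuw.
have [x _ ux] :=
  @ultra_compact_cvg _ U UU X _ u (tds_compact tdsX) (fun=> Logic.I).
have [y _ wy] :=
  @ultra_compact_cvg _ U UU X _ w (tds_compact tdsX) (fun=> Logic.I).
exists x, y; split=> [|g].
  have pix : pi \o u @ U --> pi x by exact: (cvg_comp _ _ ux (cpi _)).
  have piy : pi \o w @ U --> pi y by exact: (cvg_comp _ _ wy (cpi _)).
  have eq_uw : pi \o u = pi \o w by apply/funext.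
  rewrite -eq_uw in piy.
  exact: (cvg_unique (@metric_hausdorff _ _) pix piy).
have [cTg _] := tds_homeo tdsX g.
apply: cvg_mdist; first exact: (cvg_comp _ _ ux (cTg x)).
exact: (cvg_comp _ _ wy (cTg y)).
Qed.

(** * The Euclidean inner product *)

Lemma dotpC (R : realType) (d : nat) (u v : 'rV[R]_d) : dotp u v = dotp v u.
Proof. by apply: eq_bigr => i _; rewrite mulrC. Qed.

Lemma dotpDl (R : realType) (d : nat) (u v w : 'rV[R]_d) :
  dotp (u + v) w = dotp u w + dotp v w.
Proof. by rewrite -big_split; apply: eq_bigr => i _; rewrite mxE mulrDl. Qed.

Lemma dotpZl (R : realType) (d : nat) (a : R) (u v : 'rV[R]_d) :
  dotp (a *: u) v = a * dotp u v.
Proof.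
by rewrite /dotp mulr_sumr; apply: eq_bigr => i _; rewrite mxE mulrA.
Qed.

Lemma dotpZr (R : realType) (d : nat) (a : R) (u v : 'rV[R]_d) :
  dotp u (a *: v) = a * dotp u v.
Proof. by rewrite dotpC dotpZl dotpC. Qed.

Lemma dotp_ge0 (R : realType) (d : nat) (u : 'rV[R]_d) : 0 <= dotp u u.
Proof. by apply: sumr_ge0 => i _; rewrite -expr2 sqr_ge0. Qed.

Lemma dotp_gt0 (R : realType) (d : nat) (u : 'rV[R]_d) : u <> 0 -> 0 < dotp u u.
Proof.
move=> u0; rewrite lt_neqAle dotp_ge0 andbT; apply/eqP => /esym/eqP.
rewrite psumr_eq0 => [/allP u0'|i _]; last by rewrite -expr2 sqr_ge0.
apply: u0; apply/rowP => i; rewrite mxE.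
by have := u0' i (mem_index_enum _); rewrite mulf_eq0 orbb => /eqP.
Qed.

Lemma dotp_sqrD (R : realType) (d : nat) (u v : 'rV[R]_d) :
  dotp (u + v) (u + v) = dotp u u + 2 * dotp u v + dotp v v.
Proof.
by rewrite dotpDl [dotp u _]dotpC [dotp v _]dotpC !dotpDl (dotpC v u); ring.
Qed.

Lemma l2norm_sqr (R : realType) (d : nat) (u : 'rV[R]_d) :
  l2norm u ^+ 2 = dotp u u.
Proof. by rewrite sqr_sqrtr ?dotp_ge0. Qed.

Lemma dotp_le_l2norm (R : realType) (d : nat) (c w : 'rV[R]_d) :
  dotp c c = 1 -> dotp w c <= l2norm w.
Proof.
move=> c1; have := dotp_ge0 (w + (- dotp w c) *: c).
rewrite dotp_sqrD dotpZr dotpZl dotpZr c1 -l2norm_sqr.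
have := sqrtr_ge0 (dotp w w); rewrite -/(l2norm w).
by set n := l2norm w; set t := dotp w c; nra.
Qed.

Lemma cvg_dotp (R : realType) (d : nat) (I : Type) (F : set_system I)
    (FF : Filter F) (u w : I -> 'rV[R]_d) (u0 w0 : 'rV[R]_d) :
  (forall i, u t 0 i @[t --> F] --> u0 0 i) ->
  (forall i, w t 0 i @[t --> F] --> w0 0 i) ->
  dotp (u t) (w t) @[t --> F] --> dotp u0 w0.
Proof.
move=> uu0 ww0; apply: cvg_big => [|i _]; first exact: add_continuous.
exact: cvgM (uu0 i) (ww0 i).
Qed.

(** * The moving balls *)

Definition moving_ball (R : realType) (d : nat) (c : 'rV[R]_d) (a r : R)
    (k : nat) : set 'rV[R]_d :=
  [set u | dotp (u - (k%:R * a) *: c) (u - (k%:R * a) *: c)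
           <= (r + k%:R * a ^+ 2) ^+ 2].

(** For a point [w], measured from the center of a ball of radius [rho], that is
    swallowed by the next ball. Comparing the two squared radii bounds [<w, c>]
    from below: a point is swallowed only where the boundary moves outward. *)
Lemma moving_ball_normal (R : realType) (d : nat) (c w : 'rV[R]_d) (a rho : R) :
  dotp c c = 1 -> 0 < a <= 1 -> 0 <= rho -> rho ^+ 2 < dotp w w ->
  dotp (w - a *: c) (w - a *: c) <= (rho + a ^+ 2) ^+ 2 ->
  [/\ rho < l2norm w, l2norm w <= rho + 2 * a & - a * l2norm w < dotp w c].
Proof.
move=> c1 /andP[a0 a1] rho0; rewrite -l2norm_sqr -scaleNr dotp_sqrD.
rewrite dotpZr dotpZl dotpZr c1 -l2norm_sqr.
have := dotp_le_l2norm w c1; have := sqrtr_ge0 (dotp w w); rewrite -/(l2norm w).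
set n := l2norm w; set t := dotp w c => n0 tn rn H.
have rn' : rho < n by rewrite -(ltr_pXn2r (ltn0Sn 1)) ?nnegrE.
have a2 : a ^+ 2 <= a by nra.
split=> //.
  have : (n - a) ^+ 2 <= (rho + a ^+ 2) ^+ 2 by nra.
  case: (leP n a) => [|na]; first nra.
  have p1 : 0 <= n - a by lra.
  have p2 : 0 <= rho + a ^+ 2 by nra.
  by rewrite ler_pXn2r ?nnegrE// => ?; lra.
have : 0 < 2 * a * (t + a * n) by nra.
by rewrite pmulr_rgt0 ?mulr_gt0// => ?; lra.
Qed.

(** A large ball looks like a half-space from a point near its boundary: [w + h]
    is inside as soon as the displacement [h] points inward with slope at
    least [eta], the curvature term [|h|^2] and the gap [|w| - rho] being
    absorbed by [eta |w|]. *)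
Lemma moving_ball_interior (R : realType) (d : nat) (w h : 'rV[R]_d)
    (a rho eta : R) :
  0 <= rho -> rho < l2norm w -> l2norm w <= rho + 2 * a -> 4 * a <= eta ->
  dotp h h <= eta * l2norm w -> dotp h w <= - eta * l2norm w ->
  dotp (w + h) (w + h) <= rho ^+ 2.
Proof.
rewrite dotp_sqrD -(l2norm_sqr w) (dotpC w h).
set n := l2norm w; set t := dotp h w => rho0 rn na ae hh hw.
have H1 : (n - rho) * (n + rho) <= 2 * a * (2 * n).
  by apply: ler_pM; lra.
have H2 : 4 * a * n <= eta * n by apply: ler_wpM2r; lra.
nra.
Qed.

(** The integer part of the center, since the group acts only by lattice
    translations. *)
Definition lattice_center (R : realType) (d : nat) (c : 'rV[R]_d) (a : R)
    (k : nat) : 'rV[int]_d :=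
  \row_i Num.floor (k%:R * a * c 0 i).

(** The radii tend to infinity, so that every fixed [h] is eventually covered
    when seen from the centers. This fails for radii that stay constant, and is
    the reason for letting them grow. *)
Lemma moving_ball_exhausts (R : realType) (d : nat) (c : 'rV[R]_d) (a r : R)
    (h : 'rV[int]_d) : 0 < a -> 0 <= r ->
  exists K : nat, forall k, (K <= k)%N ->
    moving_ball c a r k (map_mx intr (h + lattice_center c a k)).
Proof.
(* [M] bounds the squared distance to the true center, uniformly in [k], since
   rounding moves each coordinate by at most 1. *)
move=> a0 r0; pose M : R := \sum_(i < d) (`|(h 0 i)%:~R| + 1) ^+ 2.
have M0 : 0 <= M by apply: sumr_ge0 => i _; exact: sqr_ge0.
have x0 : 0 <= (M + 1) / a ^+ 2 by rewrite divr_ge0 ?sqr_ge0// addr_ge0.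
exists (Num.bound ((M + 1) / a ^+ 2)) => k Kk; rewrite /moving_ball/=.
apply: (@le_trans _ _ M).
  apply: ler_sum => i _; rewrite !mxE -expr2 -real_normK ?num_real//.
  rewrite ler_pXn2r ?nnegrE ?addr_ge0// intrD -addrA.
  rewrite (le_trans (ler_normD _ _))// lerD2l.
  have /andP[] := floor_itv (k%:R * a * c 0 i); rewrite intrD => f1 f2.
  by rewrite ler_norml; apply/andP; split; lra.
have Mk : M + 1 <= k%:R * a ^+ 2.
  rewrite -ler_pdivrMr ?exprn_gt0// (le_trans (ltW (archi_boundP x0)))//.
  by rewrite ler_nat.
nra.
Qed.

Lemma finite_int_box (d N : nat) :
  finite_set [set g : 'rV[int]_d | forall i, `|g 0 i| <= N%:Z].
Proof.
pose f (m : 'rV['I_(N + N).+1]_d) : 'rV[int]_d :=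
  map_mx (fun k : 'I_(N + N).+1 => k%:Z - N%:Z) m.
apply: (@sub_finite_set _ _ (f @` [set: _])); last first.
  by apply: finite_image; exact: finite_finset.
move=> g gN; exists (map_mx (fun z : int => inord (absz (z + N%:Z))) g) => //.
apply/rowP => i; rewrite !mxE.
have := gN i; rewrite ler_norml => /andP[g1 g2].
have gp : 0 <= g 0 i + N%:Z by rewrite -lerBlDr sub0r.
rewrite inordK; first by rewrite gez0_abs ?addrK.
by rewrite ltnS -lez_nat gez0_abs// PoszD lerD2r.
Qed.

Lemma moving_ball0_finite (R : realType) (d : nat) (c : 'rV[R]_d) (a r : R) :
  finite_set [set g : 'rV[int]_d | moving_ball c a r 0 (map_mx intr g)].
Proof.
apply: (sub_finite_set _ (finite_int_box d (Num.bound (r ^+ 2)))) => g /=.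
rewrite /moving_ball/= !mul0r scale0r subr0 addr0 => Hg i.
have /(le_lt_trans Hg) H : r ^+ 2 < (Num.bound (r ^+ 2))%:R.
  by apply: archi_boundP; exact: sqr_ge0.
have Hi : ((g 0 i) ^+ 2)%:~R < (Num.bound (r ^+ 2))%:Z%:~R :> R.
  apply: le_lt_trans H; rewrite /dotp (bigD1 i)//= !mxE -intrM expr2 lerDl.
  by apply: sumr_ge0 => j _; rewrite -expr2 sqr_ge0.
rewrite ltr_int in Hi; rewrite (le_trans _ (ltW Hi))// -real_normK ?num_real//.
set z := `|g 0 i|; have : 0 <= z by exact: normr_ge0.
by case: z => [[|n]|//] _//; rewrite expr2 ler_peMl.
Qed.

(** * Pigeonhole in large fibres *)

Lemma large_uniq_seq (X : choiceType) (A : set X) (n : nat) :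
  ~ (A #<= `I_n)%card ->
  exists s : seq X, [/\ uniq s, (n < size s)%N & forall x, x \in s -> A x].
Proof.
move=> An; have [fA|iA] := pselect (finite_set A).
  exists (enum_fset (fset_set A)); split; first exact: fset_uniq.
    rewrite ltnNge; apply/negP => sA; apply: An.
    have /finite_setP[m Am] := fA.
    by rewrite (card_le_eql Am) card_le_II -(card_fset_set Am).
  by move=> x; rewrite in_fset_set// => /set_mem.
have [B BA nB] := infinite_set_fset n.+1 iA.
by exists (enum_fset B); split=> //; exact: fset_uniq.
Qed.

(** Total boundedness of [X] for the metric that takes the maximal distance over
    the translates in [G]: too many points cannot all be [e]-separated. The
    bound depends on [G] and [e] only, hence is the same for all translates of
    the point set. *)
Lemma orbit_pigeonhole (R : realType) (d : nat) (X : metricType R)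
    (T : 'rV[int]_d -> X -> X) (tdsX : dynamical_system T) (e : R)
    (G : set 'rV[int]_d) : 0 < e -> finite_set G ->
  exists N : nat, forall s : seq X, uniq s -> (N < size s)%N ->
    exists x y, [/\ x \in s, y \in s, x <> y &
      forall g, G g -> mdist (T g x) (T g y) <= e].
Proof.
move=> e0 fG; have e2 : 0 < e / 2 by rewrite divr_gt0.
pose V p := [set x | forall g, G g -> mdist (T g p) (T g x) < e / 2].
have VE p : V p = \bigcap_(g in [set` fset_set G])
    [set x | mdist (T g p) (T g x) < e / 2].
  by rewrite fset_setK.
have nV p : nbhs p (V p).
  rewrite VE; apply: filter_bigI => g _.
  have [cTg _] := tds_homeo tdsX g.
  by have /metricType_numDomainType.cvgrPdist_lt := cTg p; exact.
have [net Hnet] := compact_finite_net (tds_compact tdsX) nV.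
have [q Hq] := choice (fun x => let: ex_intro2 p a b := Hnet x in
  ex_intro (fun p => p \in net /\ V p x) p (conj a b)).
exists (size net) => s us szs; apply: contrapT => H.
have : (size (map q s) <= size net)%N.
  apply: uniq_leq_size => [|p /mapP[x _ ->]]; last by have [] := Hq x.
  rewrite map_inj_in_uniq// => x y xs ys qxy; apply: contrapT => xy.
  apply: H; exists x, y; split=> // g Gg.
  have [_ /(_ g Gg) Hx] := Hq x; have [_ /(_ g Gg) Hy] := Hq y.
  rewrite (le_trans (metric_triangle _ (T g (q x)) _))// metric_sym.
  by rewrite [leRHS]splitr lerD// ltW// qxy.
by rewrite size_map leqNgt szs.
Qed.

(** * First contact *)

Lemma same_fibre_act (R : realType) (d : nat) (X Y : metricType R)
    (T : 'rV[int]_d -> X -> X) (S : 'rV[int]_d -> Y -> Y) (pi : X -> Y) :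
  factor_map T S pi -> forall g x y, pi x = pi y -> pi (T g x) = pi (T g y).
Proof.
move=> fpi g x y xy; have E z : pi (T g z) = S g (pi z).
  by have /= -> := factor_equivariant fpi g z.
by rewrite !E xy.
Qed.

Lemma act_inj (R : realType) (d : nat) (X : metricType R)
    (T : 'rV[int]_d -> X -> X) : dynamical_system T ->
  forall g, injective (T g).
Proof.
by move=> tdsX g; have [_ [f' _ [fK _]]] := tds_homeo tdsX g; exact: can_inj fK.
Qed.

(** Expansiveness along the fibres, with constant [e]. *)
Definition fibre_separated (R : realType) (d : nat) (X : metricType R)
    (Y : Type)    (T : 'rV[int]_d -> X -> X) (pi : X -> Y) (e : R) :=
  forall x y, x <> y -> pi x = pi y -> exists g, e < mdist (T g x) (T g y).

Lemma first_jump (P : nat -> Prop) (k : nat) :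
  ~ P 0%N -> P k -> exists j, ~ P j /\ P j.+1.
Proof.
move=> P0; elim: k => [//|k IH] Pk.
by have [/IH//|nPk] := pselect (P k); exists k.
Qed.

(** A finite subset of a fibre is translated by the center of the [k]-th ball
    before the pigeonhole principle is applied. The number of points needed
    depends only on the initial ball, whereas [k] may be chosen after the
    points. *)
Lemma late_separation (R : realType) (d : nat) (X Y : metricType R)
    (T : 'rV[int]_d -> X -> X) (S : 'rV[int]_d -> Y -> Y) (pi : X -> Y)
    (tdsX : dynamical_system T) (fpi : factor_map T S pi)
    (unb : ~ bounded_to_one pi) (e : R) (c : 'rV[R]_d) (a r : R) :
  0 < e -> fibre_separated T pi e -> 0 < a -> 0 <= r ->
  exists x y : X, [/\ pi x = pi y,
    forall g, moving_ball c a r 0 (map_mx intr g) ->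
      mdist (T g x) (T g y) <= e &
    exists k g, moving_ball c a r k (map_mx intr g) /\
      e < mdist (T g x) (T g y)].
Proof.
move=> e0 sepe a0 r0.
have [N HN] := orbit_pigeonhole tdsX e0 (moving_ball0_finite c a r).
have [y0 y0N] : exists y, ~ (pi @^-1` [set y] #<= `I_N)%card.
  apply: contrapT => H; apply: unb; exists N => y.
  by apply: contrapT => yN; apply: H; exists y.
have [s [us Ns sy]] := large_uniq_seq y0N.
(* Only finitely many pairs come from [s], so one [k] can serve the places of
   separation [G] of all of them. *)
have [G HG] : {G & forall p : X * X, p.1 <> p.2 -> pi p.1 = pi p.2 ->
    e < mdist (T (G p) p.1) (T (G p) p.2)}.
  apply: (@choice _ _ (fun (p : X * X) g => p.1 <> p.2 -> pi p.1 = pi p.2 ->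
    e < mdist (T g p.1) (T g p.2))) => -[x y]/=.
  have [xy|xy] := pselect (x <> y /\ pi x = pi y); last first.
    by exists 0 => ? ?; case: xy.
  by have [g ?] := sepe x y xy.1 xy.2; exists g.
have [K HK] := choice (fun h => moving_ball_exhausts c h a0 r0).
pose k := \max_(p <- [seq (x, y) | x <- s, y <- s]) K (G p).
pose m := lattice_center c a k.
have [||x' [y' [/mapP[x xs ->] /mapP[y ys ->] xy agree]]] :=
  HN (map (T (- m)) s).
- by rewrite map_inj_uniq//; exact: act_inj.
- by rewrite size_map.
have {}xy : x <> y by move=> xy'; apply: xy; rewrite xy'.
have pxy : pi x = pi y by rewrite (sy _ xs) (sy _ ys).
exists (T (- m) x), (T (- m) y); split=> //.
  exact: (same_fibre_act fpi).
exists k, (G (x, y) + m); split.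
  apply: HK.
  apply: (@leq_bigmax_seq _ _ xpredT (fun p => K (G p)) (x, y)) => //.
  by apply/allpairsP; exists (x, y).
by rewrite -!(tds_actD tdsX) addrK; exact: (HG (x, y)).
Qed.

(** Obtained by translating the first separation met by the moving balls to the
    origin; [v] is the outward normal of the previous ball towards it. *)
Lemma almost_nondeterministic (R : realType) (d : nat) (X Y : metricType R)
    (T : 'rV[int]_d -> X -> X) (S : 'rV[int]_d -> Y -> Y) (pi : X -> Y)
    (tdsX : dynamical_system T) (fpi : factor_map T S pi)
    (unb : ~ bounded_to_one pi) (e : R) (c : 'rV[R]_d) (a r : R) :
  0 < e -> fibre_separated T pi e -> dotp c c = 1 -> 0 < a <= 1 -> 0 <= r ->
  exists (x y : X) (v : 'rV[R]_d), [/\ pi x = pi y, e < mdist x y,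
    dotp v v = 1, - a < dotp v c &
    forall (h : 'rV[int]_d) (eta : R), 4 * a <= eta ->
      dotp (map_mx intr h) (map_mx intr h) <= eta * r ->
      dotp (map_mx intr h) v <= - eta ->
      mdist (T h x) (T h y) <= e].
Proof.
move=> e0 sepe c1 a01 r0; have /andP[a0 a1] := a01.
have [x [y [pxy agree0 [K sepK]]]] :=
  late_separation tdsX fpi unb c e0 sepe a0 r0.
pose P k := exists g, moving_ball c a r k (map_mx intr g) /\
  e < mdist (T g x) (T g y).
(* The ball [k.+1] is the first one to contain a separation [g]; the ball [k] is
   still free of them. *)
have [k [nPk [g [gk sepg]]]] : exists k, ~ P k /\ P k.+1.
  apply: (first_jump (k := K)) => // -[g [/agree0]].
  by rewrite leNgt => /negP.
have agreek h : moving_ball c a r k (map_mx intr h) ->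
    mdist (T h x) (T h y) <= e.
  by move=> hk; rewrite leNgt; apply/negP => he; apply: nPk; exists h.
pose rho := r + k%:R * a ^+ 2.
have rho_r : r <= rho by rewrite lerDl mulr_ge0 ?sqr_ge0.
have rho0 : 0 <= rho by exact: le_trans rho_r.
pose w := map_mx intr g - (k%:R * a) *: c.
have w1 : rho ^+ 2 < dotp w w.
  rewrite ltNge; apply/negP => H; apply: nPk; exists g; split => //.
have w2 : dotp (w - a *: c) (w - a *: c) <= (rho + a ^+ 2) ^+ 2.
  move: gk; rewrite /moving_ball/= -[k.+1]addn1 natrD !mulrDl !mul1r.
  by rewrite scalerDl opprD !addrA.
have [rn nr tn] := moving_ball_normal c1 a01 rho0 w1 w2.
set n := l2norm w in rn nr tn.
have n0 : 0 < n by exact: le_lt_trans rn.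
exists (T g x), (T g y), (n^-1 *: w); split=> //.
- exact: (same_fibre_act fpi).
- rewrite dotpZl dotpZr -l2norm_sqr -/n expr2.
  by rewrite mulKf ?mulVf ?gt_eqF.
- by rewrite dotpZl mulrC ltr_pdivlMr.
move=> h eta aeta hh hv; rewrite -!(tds_actD tdsX); apply: agreek.
rewrite /moving_ball/= map_mxD -addrA -/w [map_mx intr h + w]addrC.
apply: (@moving_ball_interior _ _ w (map_mx intr h) a rho eta) => //.
  rewrite (le_trans hh)// ler_wpM2l//; first lra.
  exact: le_trans rho_r (ltW rn).
by move: hv; rewrite dotpZr mulrC ler_pdivrMr.
Qed.

(** Apply [almost_nondeterministic] with [a = 1 / (n + 1)], [r = n] and let [n]
    tend to infinity. Strict separation at the origin becomes [e <= mdist x y],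
    which still keeps the points apart. *)
Lemma limit_nondeterministic (R : realType) (d : nat) (X Y : metricType R)
    (T : 'rV[int]_d -> X -> X) (S : 'rV[int]_d -> Y -> Y) (pi : X -> Y)
    (tdsX : dynamical_system T) (fpi : factor_map T S pi)
    (unb : ~ bounded_to_one pi) (e : R) (c : 'rV[R]_d) :
  0 < e -> fibre_separated T pi e -> dotp c c = 1 ->
  exists (x y : X) (v : 'rV[R]_d), [/\ pi x = pi y, e <= mdist x y,
    dotp v v = 1, 0 <= dotp v c &
    forall h : 'rV[int]_d, dotp (map_mx intr h) v < 0 ->
      mdist (T h x) (T h y) <= e].
Proof.
move=> e0 sepe c1.
pose Q n (p : X * X * 'rV[R]_d) := [/\ pi p.1.1 = pi p.1.2,
    e < mdist p.1.1 p.1.2, dotp p.2 p.2 = 1, - n.+1%:R^-1 < dotp p.2 c &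
    forall (h : 'rV[int]_d) (eta : R), 4 * n.+1%:R^-1 <= eta ->
      dotp (map_mx intr h) (map_mx intr h) <= eta * n%:R ->
      dotp (map_mx intr h) p.2 <= - eta ->
      mdist (T h p.1.1) (T h p.1.2) <= e].
have [p Hp] : {p & forall n, Q n (p n)}.
  apply: choice => n.
  have n1 : 0 < (n.+1%:R^-1 : R) <= 1.
    by rewrite invr_gt0 ltr0n/= invf_le1 ?ler1n ?ltr0n.
  have [x [y [v H]]] :=
    almost_nondeterministic tdsX fpi unb e0 sepe c1 n1 (ler0n R n).
  by exists (x, y, v).
have [U UU ooU] := eventually_ultra.
have [x [y [pxy lim_xy]]] :=
  @ultra_pair_limit _ _ _ _ T pi tdsX (factor_continuous fpi) _ U UU
    (fun n => (p n).1.1) (fun n => (p n).1.2)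
    (fun n => let: And5 H _ _ _ _ := Hp n in H).
have [v Hv] : {v : 'I_d -> R & forall i, (p n).2 0 i @[n --> U] --> v i}.
  apply: (@choice _ _ (fun (i : 'I_d) (l : R) =>
    (p n).2 0 i @[n --> U] --> l)) => i.
  have [|l _ Hl] := @ultra_compact_cvg _ U UU R _ (fun n => (p n).2 0 i)
      (@segment_compact R (-1) 1).
    move=> n; rewrite /= in_itv/= -ler_norml.
    have [_ _ v1 _ _] := Hp n.
    rewrite -(@ler_pXn2r _ 2) ?nnegrE// expr1n real_normK ?num_real// -v1 /dotp.
    rewrite (bigD1 i)//= expr2 lerDl; apply: sumr_ge0 => j _.
    by rewrite -expr2 sqr_ge0.
  by exists l.
pose V : 'rV[R]_d := \row_i v i.
have limV i : (p n).2 0 i @[n --> U] --> V 0 i by rewrite mxE.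
have lim_dotp (u : 'rV[R]_d) : dotp u (p n).2 @[n --> U] --> dotp u V.
  by apply: cvg_dotp => // i; exact: cvg_cst.
have lim_norm : dotp (p n).2 (p n).2 @[n --> U] --> dotp V V.
  exact: cvg_dotp.
have lim_harmonic : harmonic n @[n --> U] --> (0 : R).
  by apply: cvg_trans cvg_harmonic; exact: cvg_app.
exists x, y, V; split=> //.
- have := lim_xy 0; rewrite !(tds_act0 tdsX) => lim0.
  apply: (closed_cvg _ (@closed_ge _ e) _ _ lim0); apply: nearW => n.
  by rewrite !(tds_act0 tdsX); have [_ /ltW] := Hp n.
- apply: (closed_cvg _ (@closed_eq _ (1 : R)) _ _ lim_norm); apply: nearW => n.
  by have [] := Hp n.
- have lim1 : harmonic n + dotp c (p n).2 @[n --> U] --> 0 + dotp c V.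
    exact: cvgD.
  rewrite dotpC -[leRHS]add0r.
  apply: (closed_cvg _ (@closed_ge _ (0 : R)) _ _ lim1); apply: nearW => n.
  have [_ _ _ H _] := Hp n.
  by rewrite /harmonic/= (dotpC c) addrC -lerBlDr sub0r ltW.
(* For fixed [h] with [<h, V> < 0], the restrictions on [h] in [Q n] hold with
   this slope once [n] is large. *)
move=> h hV; pose eta := - dotp (map_mx intr h) V / 2.
have eta0 : 0 < eta by rewrite divr_gt0// oppr_gt0.
apply: (closed_cvg _ (@closed_le _ e) _ _ (lim_xy h)).
have U1 : \forall n \near U, dotp (map_mx intr h) (p n).2 <= - eta.
  by apply: (cvgr_le _ (lim_dotp (map_mx intr h))); rewrite /eta; lra.
have U2 : \forall n \near U, 4 / eta <= n%:R :> R.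
  by apply: ooU; exact: nbhs_infty_ger.
have U3 : \forall n \near U,
    dotp (map_mx intr h) (map_mx intr h) / eta <= n%:R :> R.
  by apply: ooU; exact: nbhs_infty_ger.
apply: (filterS3 _ _ U1 U2 U3) => n H1 H2 H3.
have [_ _ _ _ H] := Hp n; apply: (H h eta) => //.
  rewrite ler_pdivrMr ?ltr0n// mulrC -ler_pdivrMr//.
  by rewrite (le_trans H2)// ler_nat.
by rewrite mulrC -ler_pdivrMr.
Qed.

(** * From one scale to all scales *)

(** Pairs violating this for every [N] would accumulate at a pair of distinct
    points in one fibre that is nowhere separated. *)
Lemma uniform_separation (R : realType) (d : nat) (X Y : metricType R)
    (T : 'rV[int]_d -> X -> X) (pi : X -> Y)
    (tdsX : dynamical_system T) (cpi : continuous pi) (e eps : R) :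
  0 < eps -> fibre_separated T pi e ->
  exists N : nat, forall x y, pi x = pi y ->
    (forall g : 'rV[int]_d, (forall i, `|g 0 i| <= N%:Z) ->
       mdist (T g x) (T g y) <= e) ->
    mdist x y <= eps.
Proof.
move=> eps0 sepe; apply: contrapT => nuni.
pose Q (n : nat) (p : X * X) := [/\ pi p.1 = pi p.2, eps < mdist p.1 p.2 &
  forall g : 'rV[int]_d, (forall i, `|g 0 i| <= n%:Z) ->
    mdist (T g p.1) (T g p.2) <= e].
have [p Hp] : {p & forall n, Q n (p n)}.
  apply: (@choice _ _ Q) => n; apply: contrapT => nQ; apply: nuni.
  exists n => x y pxy agree; rewrite leNgt; apply/negP => xy.
  by apply: nQ; exists (x, y).
have [U UU ooU] := eventually_ultra.
have [x [y [pxy lim_xy]]] :=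
  @ultra_pair_limit _ _ _ _ T pi tdsX cpi _ U UU (fun n => (p n).1)
    (fun n => (p n).2) (fun n => let: And3 H _ _ := Hp n in H).
have eps_xy : eps <= mdist x y.
  have := lim_xy 0; rewrite !(tds_act0 tdsX) => lim0.
  apply: (closed_cvg _ (@closed_ge _ eps) _ _ lim0); apply: nearW => n.
  by rewrite !(tds_act0 tdsX); have [_ /ltW] := Hp n.
have [|g] := sepe x y _ pxy.
  by move=> xy; move: eps_xy; rewrite xy mdistxx leNgt eps0.
apply/negP; rewrite -leNgt.
apply: (closed_cvg _ (@closed_le _ e) _ _ (lim_xy g)).
have Ug : \forall n \near U, forall i, `|g 0 i| <= n%:Z.
  apply: ooU; exists (\max_i absz (g 0%R i)) => // n /= gn i.
  by rewrite -abszE lez_nat (leq_trans _ gn)//; exact: leq_bigmax.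
by apply: (filterS _ Ug) => n gn; have [_ _] := Hp n; exact.
Qed.

Lemma box_bound (R : realType) (d : nat) (v : 'rV[R]_d) (N : nat) :
  exists m : 'rV[int]_d, forall h : 'rV[int]_d, (forall i, `|h 0 i| <= N%:Z) ->
    dotp (map_mx intr h) v <= dotp (map_mx intr m) v.
Proof.
(* The linear form [<_, v>] is maximal on the box at this point. *)
exists (\row_i (N%:Z * sgz (v 0 i))) => h hN; apply: ler_sum => i _.
rewrite !mxE intrM -mulrA -sgrEz -normrEsg (le_trans (ler_norm _))//.
by rewrite normrM ler_wpM2r// -intr_norm ler_int.
Qed.

(** One pair of agreement scale [e] yields pairs for every [eps], with the same
    [v]: the loss of a bounded strip along the boundary of the half-space is
    compensated by translating the pair by [m]. *)
Lemma half_space_nondeterministic (R : realType) (d : nat) (X Y : metricType R)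
    (T : 'rV[int]_d -> X -> X) (S : 'rV[int]_d -> Y -> Y) (pi : X -> Y)
    (tdsX : dynamical_system T) (fpi : factor_map T S pi) (e : R)
    (x y : X) (v : 'rV[R]_d) :
  fibre_separated T pi e -> dotp v v = 1 -> x <> y -> pi x = pi y ->
  (forall h : 'rV[int]_d, dotp (map_mx intr h) v < 0 ->
     mdist (T h x) (T h y) <= e) ->
  ND T pi v.
Proof.
move=> sepe v1 xy pxy agree eps eps0; split.
  by rewrite /unit_sphere/= /l2norm v1 sqrtr1.
have [N HN] := uniform_separation tdsX (factor_continuous fpi) eps0 sepe.
have [m Hm] := box_bound v N.
exists (T (- m) x), (T (- m) y); split.
- by move/(act_inj tdsX).
- exact: (same_fibre_act fpi).
move=> g gv; rewrite -!(tds_actD tdsX); apply: HN => [|h /Hm hm].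
  exact: (same_fibre_act fpi).
rewrite -!(tds_actD tdsX); apply: agree.
rewrite !map_mxD !dotpDl map_mxN -scaleN1r dotpZl; lra.
Qed.

Theorem theorem5p5 (R : realType) (d : nat) (d_ge1 : (1 <= d)%N)
    (X Y : metricType R)
    (T : 'rV[int]_d -> X -> X) (S : 'rV[int]_d -> Y -> Y) (pi : X -> Y)
    (tdsX : dynamical_system T) (tdsY : dynamical_system S)
    (fpi : factor_map T S pi) (unb : ~ bounded_to_one pi)
    (c : 'rV[R]_d) (c_neq0 : c <> 0) :
  ND T pi `&` half_space c !=set0.
Proof.
have cc := dotp_gt0 c_neq0.
have n0 : 0 < l2norm c by rewrite sqrtr_gt0.
pose u := (l2norm c)^-1 *: c.
have u1 : dotp u u = 1.
  by rewrite dotpZl dotpZr -l2norm_sqr expr2 mulKf ?mulVf ?gt_eqF.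
have half_u v : 0 <= dotp v u -> half_space c v.
  by rewrite dotpZr pmulr_rge0// invr_gt0.
have [[e e0 sepe]|nsep] := pselect (exists2 e, 0 < e & fibre_separated T pi e).
  have [x [y [v [pxy exy v1 vu agree]]]] :=
    limit_nondeterministic tdsX fpi unb e0 sepe u1.
  exists v; split; last exact: half_u.
  apply: (half_space_nondeterministic tdsX fpi sepe v1 _ pxy agree) => xy.
  by move: exy; rewrite xy mdistxx leNgt e0.
exists u; split; last by apply: half_u; rewrite u1.
move=> eps eps0; split; first by rewrite /unit_sphere/= /l2norm u1 sqrtr1.
apply: contrapT => H; apply: nsep; exists eps => // x y xy pxy.
apply: contrapT => Hg; apply: H; exists x, y; split=> // g _.
by rewrite leNgt; apply/negP => eg; apply: Hg; exists g.
Qed.
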